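(* Let $1\le k\le n$ be integers. Every $k$-separable pure state $|\psi\rangle\in\mathcal H^{\otimes n}$ satisfies $$F_{|\psi\rangle}\le\left\lfloor\frac nk\right\rfloor k^2+\left(n-\left\lfloor\frac nk\right\rfloor k\right)^2\le nk.$$
   Context: $\mathcal H$ is a complex Hilbert space (finite or infinite-dimensional), $\hat H$ is a self-adjoint operator on $\mathcal H$ with non-degenerate spectrum. On $\mathcal H^{\otimes n}$, $\hat H_i=\mathbf 1^{\otimes(i-1)}\otimes\hat H\otimes\mathbf 1^{\otimes(n-i)}$ and $\hat H_{\mathrm{coll}}=\sum_{i=1}^n\hat H_i$. Pure states are unit vectors; $\Delta_{|\psi\rangle}(\hat A)=\langle\psi|\hat A^2|\psi\rangle-\langle\psi|\hat A|\psi\rangle^2$ denotes the variance. For a pure state $|\psi\rangle\in\mathcal H^{\otimes n}$, $F_{|\psi\rangle}=\Delta_{|\psi\rangle}(\hat H_{\mathrm{coll}})/\max_{1\le i\le n}\Delta_{|\psi\rangle}(\hat H_i)$ if the denominator is nonzero, and $F_{|\psi\rangle}=0$ otherwise. A pure state $|\psi\rangle\in\mathcal H^{\otimes n}$ is $k$-separable if, after a permutation of the $n$ tensor factors, $|\psi\rangle=|\phi_1\rangle\otimes\cdots\otimes|\phi_l\rangle$ with $|\phi_i\rangle\in\mathcal H^{\otimes r_i}$, $1\le r_i\le k$, $\sum_ir_i=n$. If $\hat H$ is unbounded, only states lying in the domain of every $\hat H_i$ (so that all variances are finite) are considered. *)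

(* Defs.v *)
From mathcomp Require Import all_boot all_order all_algebra.
From mathcomp Require Import all_classical all_reals all_analysis.
From mathcomp.real_closed Require Import complex.

Set Implicit Arguments.
Unset Strict Implicit.
Unset Printing Implicit Defensive.

Import Order.TTheory GRing.Theory Num.Theory.
Import numFieldNormedType.Exports.

Local Open Scope classical_set_scope.
Local Open Scope ring_scope.

Record hilbertType (R : realType) := Hilbert {
  hilbert_sort :> completeNormedModType R[i];
  hilbert_dot : {dot hilbert_sort for Num.conj};
  hilbert_normE : forall u : hilbert_sort, `|u| ^+ 2 = hilbert_dot u u
}.

(* The library's forms are linear in the first argument; the Dirac bracket
   <u|v> is linear in v and conjugate-linear in u. *)
Definition braket (R : realType) (V : hilbertType R) (u v : V) : R[i] :=
  hilbert_dot V v u.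

Definition is_pure_state (R : realType) (V : hilbertType R) (psi : V) : Prop :=
  `|psi| = 1.

Definition lspan (C : pzRingType) (V : lmodType C) (S : set V) : set V :=
  [set v | exists (m : nat) (c : 'I_m -> C) (w : 'I_m -> V),
     (forall j, S (w j)) /\ v = \sum_j c j *: w j].

(* A possibly unbounded operator; its values off [opdom] are irrelevant. *)
Record operator (R : realType) (V : hilbertType R) := Operator {
  opdom : set V;
  app :> V -> V
}.

Definition linear_operator (R : realType) (V : hilbertType R)
    (A : operator V) : Prop :=
  forall (a : R[i]) (u v : V), opdom A u -> opdom A v ->
    opdom A (a *: u + v) /\ A (a *: u + v) = a *: A u + A v.

(* The last clause says that A and its adjoint have the same graph: (u, w) is in
   the graph of the adjoint iff <A v|u> = <v|w> for every v in the domain. *)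
Definition self_adjoint (R : realType) (V : hilbertType R)
    (A : operator V) : Prop :=
  [/\ linear_operator A,
      dense (opdom A) &
      forall u w : V, (opdom A u /\ w = A u) <->
        (forall v : V, opdom A v -> braket (A v) u = braket v w)].

(* Every eigenspace has dimension at most one. *)
Definition nondegenerate_spectrum (R : realType) (V : hilbertType R)
    (A : operator V) : Prop :=
  forall (a : R[i]) (u v : V), opdom A u -> opdom A v ->
    A u = a *: u -> A v = a *: v -> u != 0 -> exists c : R[i], v = c *: u.

(* The operator whose graph is the closure of the linear span of G. It is
   meaningful when that closure is single-valued (G closable). *)
Definition closure_operator (R : realType) (V : hilbertType R)
    (G : set (V * V)) : operator V :=
  Operator [set u | exists w, closure (lspan G) (u, w)]
           (fun u => xget 0 [set w | closure (lspan G) (u, w)]).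

(* (T, tens) is a Hilbert-space tensor product of the finite family K: this
   determines (T, tens) up to a unique unitary isomorphism. *)
Definition is_hilbert_tensor (R : realType) (J : finType)
    (K : J -> hilbertType R) (T : hilbertType R)
    (tens : (forall j, K j) -> T) : Prop :=
  [/\ forall (x : forall j, K j) (i : J) (a : R[i]) (u v : K i),
        tens (dfwith x i (a *: u + v)) =
          a *: tens (dfwith x i u) + tens (dfwith x i v),
      forall x y : (forall j, K j),
        braket (tens x) (tens y) = \prod_j braket (x j) (y j) &
      dense (lspan (range tens))].

(* The tensor powers of H, with x_1, .., x_r |-> x_1 (x) .. (x) x_r. *)
Record tensor_powers (R : realType) (H : hilbertType R) := TensorPowers {
  tpow :> nat -> hilbertType R;
  ptens : forall r : nat, ('I_r -> H) -> tpow r;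
  ptensP : forall r : nat,
    @is_hilbert_tensor R 'I_r (fun=> H) (tpow r) (@ptens r)
}.

(* 1 (x) .. (x) A (x) .. (x) 1 with A in slot i: the closure of the operator
   acting on the algebraic tensors whose i-th factor is in the domain of A. *)
Definition site_op (R : realType) (H : hilbertType R) (T : tensor_powers H)
    (A : operator H) (n : nat) (i : 'I_n) : operator (T n) :=
  closure_operator
    [set (ptens T x, ptens T (dfwith x i (A (x i))))
       | x in [set x : 'I_n -> H | opdom A (x i)]].

Definition coll_op (R : realType) (H : hilbertType R) (T : tensor_powers H)
    (A : operator H) (n : nat) : operator (T n) :=
  Operator [set psi | forall i : 'I_n, opdom (site_op T A i) psi]
           (fun psi => \sum_(i < n) site_op T A i psi).

(* For symmetric A and psi in the domain of A, <psi|A^2|psi> is read as the quadratic form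
   <A psi|A psi>, which is finite even when A psi is not in that domain; both brackets
   are then real numbers. *)
Definition variance (R : realType) (V : hilbertType R) (A : operator V)
    (psi : V) : R :=
  complex.Re (braket (A psi) (A psi)) - complex.Re (braket psi (A psi)) ^+ 2.

(* Variances of unit vectors are nonnegative, so starting the maximum from 0
   does not change it when n > 0. *)
Definition max_site_variance (R : realType) (H : hilbertType R)
    (T : tensor_powers H) (A : operator H) (n : nat) (psi : T n) : R :=
  \big[Num.max/0]_(i < n) variance (site_op T A i) psi.

Definition Findex (R : realType) (H : hilbertType R) (T : tensor_powers H)
    (A : operator H) (n : nat) (psi : T n) : R :=
  if max_site_variance A psi == 0 then 0
  else variance (coll_op T A n) psi / max_site_variance A psi.

(* The canonical identification of the tensor product over b of the r_b-th
   tensor powers with the n-th tensor power, the j-th slot of block b being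
   placed at site s (b, j). It is determined by its values on product vectors. *)
Definition is_regrouping (R : realType) (H : hilbertType R)
    (T : tensor_powers H) (n l : nat) (r : 'I_l -> nat)
    (s : {b : 'I_l & 'I_(r b)} -> 'I_n) (m : (forall b, T (r b)) -> T n) : Prop :=
  is_hilbert_tensor m /\
  forall x : 'I_n -> H,
    m (fun b => ptens T (fun j : 'I_(r b) => x (s (existT _ b j)))) = ptens T x.

(* The bijection s encodes the permutation of the factors, and forces the sum of
   the r_b to be n. *)
Definition k_separable (R : realType) (H : hilbertType R)
    (T : tensor_powers H) (n k : nat) (psi : T n) : Prop :=
  exists (l : nat) (r : 'I_l -> nat) (s : {b : 'I_l & 'I_(r b)} -> 'I_n)
         (m : (forall b, T (r b)) -> T n) (phi : forall b, T (r b)),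
    [/\ forall b, (1 <= r b <= k)%N,
        bijective s,
        is_regrouping s m &
        psi = m phi].

(* Main.v *)
(** Let w_i be the image of psi under the i-th site operator. The variance of
    the collective operator is the sum over (i, j) of the covariances
    Re <w_i|w_j> - <psi|w_i><psi|w_j>. Each is at most the maximal site
    variance, and it vanishes when i and j lie in different blocks, so the ratio
    is at most the sum of the squared block sizes; at fixed total size and
    sizes at most k this sum is largest when all blocks but one have size k.
    The covariance vanishes because w_i lies, at least weakly, in the slice of
    vectors that differ from psi in the block of i only: compressing to the
    slice commutes with the site operator on algebraic tensors, and this
    passes to the closure of the graph. *)
Require Import Defs.
From mathcomp Require Import all_boot all_order all_algebra.
From mathcomp Require Import all_classical all_reals all_analysis.
From mathcomp.real_closed Require Import complex.
From mathcomp Require Import ring lra zify.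

Local Open Scope ring_scope.
Set Implicit Arguments.
Unset Strict Implicit.
Unset Printing Implicit Defensive.
Import Order.TTheory GRing.Theory Num.Theory.
Import numFieldNormedType.Exports.
Local Open Scope classical_set_scope.

(** * Algebra of the bracket and the Cauchy-Schwarz inequality *)

Section Braket.
Variables (R : realType) (V : hilbertType R).
Implicit Types (a : R[i]) (u v w : V).

Lemma braketDr u v w : braket u (v + w) = braket u v + braket u w.
Proof. by rewrite /braket linearDl. Qed.

Lemma braketDl u v w : braket (u + v) w = braket u w + braket v w.
Proof. by rewrite /braket linearDr. Qed.

Lemma braketZr a u v : braket u (a *: v) = a * braket u v.
Proof. by rewrite /braket linearZl. Qed.

Lemma braketZl a u v : braket (a *: u) v = a^* * braket u v.
Proof. by rewrite /braket linearZr. Qed.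

Lemma braket0r u : braket u 0 = 0.
Proof. by rewrite /braket linear0l. Qed.

Lemma braket0l u : braket 0 u = 0.
Proof. by rewrite /braket linear0r. Qed.

Lemma braketBr u v w : braket u (v - w) = braket u v - braket u w.
Proof. by rewrite /braket linearBl. Qed.

Lemma braketBl u v w : braket (u - v) w = braket u w - braket v w.
Proof. by rewrite /braket linearBr. Qed.

Lemma braketC u v : braket v u = (braket u v)^*.
Proof. by rewrite /braket hermC expr0 mul1r. Qed.

Lemma sqr_normE u : `|u| ^+ 2 = braket u u.
Proof. exact: hilbert_normE. Qed.

Lemma braket_ge0 u : 0 <= braket u u.
Proof. by rewrite -sqr_normE exprn_ge0. Qed.

Lemma cauchy_schwarz u v : `|braket u v| <= `|u| * `|v|.
Proof.
rewrite -(@ler_pXn2r _ 2) ?nnegrE ?mulr_ge0// exprMn !sqr_normE normCK -braketC.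
have [->|v0] := eqVneq v 0; first by rewrite !braket0r mul0r mulr0.
have s_gt0 : 0 < braket v v by rewrite -sqr_normE exprn_gt0// normr_gt0.
(* The squared norm of this vector is [<v|v>] times the Cauchy-Schwarz deficit, which avoids square
   roots and division. *)
have := braket_ge0 (braket v v *: u - braket v u *: v).
rewrite !(braketBl, braketBr, braketZl, braketZr) (geC0_conj (ltW s_gt0)).
rewrite -braketC.
rewrite (_ : _ - _ = braket v v * (braket u u * braket v v
                                   - braket u v * braket v u)); last by ring.
by rewrite pmulr_rge0// subr_ge0.
Qed.

End Braket.

(** * Linear spans *)

Section LSpan.
Variables (C : pzRingType) (V : lmodType C).
Implicit Types (S P : set V).

Lemma lspan_ind S P : P 0 -> (forall a u v, P u -> P v -> P (a *: u + v)) ->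
  S `<=` P -> lspan S `<=` P.
Proof.
move=> P0 PD SP _ [m [c [w [Sw ->]]]].
by elim/big_rec: _ => // j x _ Px; apply: PD => //; apply/SP/Sw.
Qed.

Lemma lspan0 S : lspan S 0.
Proof.
by exists 0%N, (fun=> 0), (fun=> 0); split=> [[]//|]; rewrite big_ord0.
Qed.

Lemma lspanZD S a u v : S u -> lspan S v -> lspan S (a *: u + v).
Proof.
move=> Su [m [c [w [Sw ->]]]].
exists m.+1, (fun j => if unlift ord0 j is Some j' then c j' else a),
  (fun j => if unlift ord0 j is Some j' then w j' else u).
split; first by move=> j; case: unliftP.
rewrite big_ord_recl unlift_none; congr (_ + _).
by apply: eq_bigr => j _; rewrite liftK.
Qed.

Lemma sub_lspan S : S `<=` lspan S.
Proof.
by move=> u Su; rewrite -[u]addr0 -[u]scale1r; apply: lspanZD (lspan0 S).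
Qed.

Lemma lspan_linear S a u v : lspan S u -> lspan S v -> lspan S (a *: u + v).
Proof.
move=> Su Sv; move: u Su a v Sv.
apply: (@lspan_ind S (fun u => forall a v, lspan S v -> lspan S (a *: u + v))).
- by move=> a v Sv; rewrite scaler0 add0r.
- move=> a u v IHu IHv b w Sw.
  by rewrite scalerDr scalerA -addrA; apply: IHu; apply: IHv.
- by move=> u Su a v Sv; apply: lspanZD.
Qed.

End LSpan.

(** * Closure and density in terms of the norm *)

Section Approx.
Variables (R : realType) (V : hilbertType R).

Lemma closure_prod_norm (G : set (V * V)) u w : closure G (u, w) ->
  forall e : R[i], 0 < e -> exists2 p, G p & `|u - p.1| < e /\ `|w - p.2| < e.
Proof.
move=> cG e e0; have /cG[p [Gp]] : nbhs (u, w) (ball (u, w) e).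
  exact: nbhsx_ballx.
by case; rewrite -!ball_normE /= => ? ?; exists p.
Qed.

Lemma dense_norm (S : set V) : dense S ->
  forall (u : V) (e : R[i]), 0 < e -> exists2 v, S v & `|u - v| < e.
Proof.
move=> dS u e e0; have [] := dS (ball u e)^°; first last.
- by move=> v [/interior_subset + Sv]; rewrite -ball_normE; exists v.
- exact: open_interior.
- by exists u; apply: nbhsx_ballx.
Qed.

End Approx.

Lemma norm_small_eq0 (C : numFieldType) (x c : C) : 0 <= c ->
  (forall e, 0 < e -> `|x| <= e * c) -> x = 0.
Proof.
move=> c0 small; apply/eqP; rewrite -normr_le0.
have c1 : 0 < c + 1 by rewrite ltr_wpDl.
have [->|x0] := eqVneq x 0; first by rewrite normr0.
(* For this [e] the hypothesis reads [|x| (c + 1) <= |x| c]. *)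
have /small : 0 < `|x| / (c + 1) by rewrite divr_gt0 ?normr_gt0.
by rewrite mulrAC ler_pdivlMr// mulrDr mulr1 gerDl.
Qed.

(** * Symmetric graphs, their closures and their compressions *)

Section WeakCompression.
Variables (R : realType) (V : hilbertType R).
Implicit Types (G : set (V * V)) (M : set V).

Definition symmetric_graph G :=
  forall p q, G p -> G q -> braket p.2 q.1 = braket p.1 q.2.

Definition orthoset M : set V := [set z | forall m, M m -> braket m z = 0].

(* [r] is the pair of orthogonal projections of [p] to [M], for a projection
   that commutes, in the weak sense, with the operator of graph [G]. *)
Definition compression M G p r : Prop :=
  [/\ M r.1 /\ M r.2, orthoset M (p.1 - r.1), orthoset M (p.2 - r.2) &
      forall q, G q -> braket r.1 q.2 = braket r.2 q.1].

Lemma orthoset_linear M a u v : orthoset M u -> orthoset M v ->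
  orthoset M (a *: u + v).
Proof.
by move=> Mu Mv m Mm; rewrite braketDr braketZr Mu// Mv// mulr0 addr0.
Qed.

(** Orthogonality gives [<u|v> = |u|^2], to which Cauchy-Schwarz applies. *)
Lemma norm_projection_le M u v : M u -> orthoset M (v - u) -> `|u| <= `|v|.
Proof.
move=> Mu Mvu; have [->|u0] := eqVneq u 0; first by rewrite normr0.
have /eqP := Mvu _ Mu; rewrite braketBr subr_eq0 => /eqP uv.
have := cauchy_schwarz u v.
by rewrite uv -sqr_normE normrX normr_id expr2 ler_pM2l// normr_gt0.
Qed.

(** Passage to the limit: approximating [(u, w)] within [e] by a pair of [G] costs at most
    [e (|z| + |q|)]. *)
Lemma closure_graph_braket G z q :
  (forall p, G p -> braket p.2 z = braket p.1 q) ->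
  forall u w, closure G (u, w) -> braket w z = braket u q.
Proof.
move=> Gsym u w /closure_prod_norm cG; apply/eqP; rewrite -subr_eq0; apply/eqP.
apply: (@norm_small_eq0 _ _ (`|z| + `|q|)); first exact: addr_ge0.
move=> e /cG[[u' w'] /= Gp [uu' ww']].
rewrite (_ : _ - _ = braket (w - w') z - braket (u - u') q); last first.
  by rewrite !braketBl (Gsym _ Gp)/=; ring.
rewrite mulrDr (le_trans (ler_normB _ _))// lerD//.
  by rewrite (le_trans (cauchy_schwarz _ _))// ler_wpM2r// ltW.
by rewrite (le_trans (cauchy_schwarz _ _))// ler_wpM2r// ltW.
Qed.

Lemma lspan_graph_braket G z q :
  (forall p, G p -> braket p.2 z = braket p.1 q) ->
  forall p, lspan G p -> braket p.2 z = braket p.1 q.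
Proof.
move=> Gsym p; apply: (@lspan_ind _ _ G
  (fun p : (V * V)%type => braket p.2 z = braket p.1 q)) => //.
- by rewrite !braket0l.
- by move=> a u v /= Gu Gv; rewrite !(braketDl, braketZl) Gu Gv.
Qed.

Lemma braket_flip (u v w z : V) :
  braket u v = braket w z -> braket v u = braket z w.
Proof. by rewrite [braket v u]braketC [braket z w]braketC => ->. Qed.

(** The identity extends from [G] to its span and then to the closure, in one argument at a time;
    [braket_flip] exchanges the arguments in between. *)
Lemma symmetric_closure G : symmetric_graph G ->
  symmetric_graph (closure (lspan G)).
Proof.
move=> Gsym [u w] [u' w'] cG cG'; apply: closure_graph_braket cG => p Gp.
apply/esym/braket_flip; apply: closure_graph_braket cG' => p' Gp'.
apply/braket_flip/esym; apply: lspan_graph_braket Gp => q Gq.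
apply/esym/braket_flip; apply: lspan_graph_braket Gp' => q' Gq'.
exact/braket_flip/esym/Gsym.
Qed.

Lemma compression_lspan M G :
  M 0 -> (forall a u v, M u -> M v -> M (a *: u + v)) ->
  (forall p, G p -> exists r, compression M G p r) ->
  forall p, lspan G p -> exists r, compression M (lspan G) p r.
Proof.
move=> M0 MD GM; apply: lspan_ind.
- exists 0; split=> //=; first by rewrite subr0 => m _; rewrite braket0r.
    by rewrite subr0 => m _; rewrite braket0r.
  by move=> q _; rewrite !braket0l.
- move=> a p p' [r [[Mr1 Mr2] pr1 pr2 rG]] [r' [[Mr'1 Mr'2] pr'1 pr'2 r'G]].
  exists (a *: r + r'); split=> /=.
  + by split; apply: MD.
  + rewrite (_ : _ - _ = a *: (p.1 - r.1) + (p'.1 - r'.1)); last first.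
      by rewrite scalerBr opprD addrACA.
    exact: orthoset_linear.
  + rewrite (_ : _ - _ = a *: (p.2 - r.2) + (p'.2 - r'.2)); last first.
      by rewrite scalerBr opprD addrACA.
    exact: orthoset_linear.
  + by move=> q Gq; rewrite !(braketDl, braketZl) rG// r'G.
- move=> p /GM[r [Mr pr1 pr2 rG]]; exists r; split=> // q Gq.
  apply/braket_flip; apply: lspan_graph_braket Gq => q' Gq'.
  exact/braket_flip/rG.
Qed.

(* Approximating [psi] by [p] in the span of [G], and projecting [p] to [M],
   bounds [<w|q>] for [q] in the domain by the distance of [q] to [z]. This
   avoids both the projection theorem and the completeness of [V]. *)
Lemma closure_graph_ortho M G psi w z :
  M 0 -> (forall a u v, M u -> M v -> M (a *: u + v)) ->
  symmetric_graph G ->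
  (forall u (e : R[i]), 0 < e -> exists2 q, lspan G q & `|u - q.1| < e) ->
  (forall p, G p -> exists r, compression M G p r) ->
  closure (lspan G) (psi, w) -> M psi -> orthoset M z -> braket w z = 0.
Proof.
move=> M0 MD Gsym Gdense GM cG Mpsi Mz.
apply: (@norm_small_eq0 _ _ (`|w| *+ 2 + 1)).
  by rewrite addr_ge0// mulrn_wge0.
move=> d d0; have [q Gq qz] := Gdense z d d0.
(* There is no control on [|q.2|] as [q] approaches [z], so [e] is chosen after [q]: the error terms
   carrying [e] add up to [e * c], which is at most [d]. *)
pose c := `|q.2| + d; have c0 : 0 < c by rewrite ltr_wpDl.
have c1 : 0 < c + 1 by rewrite ltr_wpDr.
have e0 : 0 < d / (c + 1) by rewrite divr_gt0.
set e := d / (c + 1) in e0.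
have [p Gp [psip wp]] := closure_prod_norm cG e0.
have [r [[Mr1 Mr2] pr1 pr2 rG]] := compression_lspan M0 MD GM Gp.
(* [psi - r.1] is the projection to [M] of [psi - p.1]. *)
have psir : `|psi - r.1| <= e.
  apply: le_trans (ltW psip); apply: (@norm_projection_le M).
    by rewrite addrC -scaleN1r; apply: MD.
  rewrite (_ : _ - _ = (-1) *: (p.1 - r.1) + 0).
    by apply: orthoset_linear => // m _; rewrite braket0r.
  by rewrite addr0 scaleN1r opprD opprK addrACA subrr add0r opprB addrC.
have r2 : `|r.2| <= `|w| + e.
  apply: le_trans (norm_projection_le Mr2 pr2) _.
  rewrite (_ : p.2 = w - (w - p.2)); last by rewrite opprB addrC subrK.
  by rewrite (le_trans (ler_normB _ _))// lerD2l ltW.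
have wq : braket w q.1 = braket psi q.2.
  apply: closure_graph_braket cG => p' Gp'.
  by apply: (symmetric_closure Gsym); apply: subset_closure.
(* The extra terms cancel: [<w|q.1> = <psi|q.2>] by symmetry of the closure, [<r.1|q.2> = <r.2|q.1>]
   by compression, and [<r.2|z> = 0]. Each bracket on the right has a small argument. *)
rewrite (_ : braket w z = braket w (z - q.1) + braket (psi - r.1) q.2
                          - braket r.2 (z - q.1)); last first.
  by rewrite !braketBr braketBl wq (rG _ Gq) (Mz _ Mr2); ring.
apply: (@le_trans _ _ (`|w| * d + e * `|q.2| + (`|w| + e) * d)).
  rewrite (le_trans (ler_normB _ _))// lerD//.
    rewrite (le_trans (ler_normD _ _))// lerD//.
      by rewrite (le_trans (cauchy_schwarz _ _))// ler_wpM2l// ltW.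
    by rewrite (le_trans (cauchy_schwarz _ _))// ler_wpM2r.
  by rewrite (le_trans (cauchy_schwarz _ _))// ler_pM// ltW.
rewrite (_ : _ + _ = d * (`|w| *+ 2) + e * c); last by rewrite /c; ring.
rewrite [leRHS]mulrDr mulr1 lerD2l /e mulrAC ler_pdivrMr// ler_pM2l// lerDl.
exact: ler01.
Qed.

End WeakCompression.

Lemma self_adjoint_symmetric (R : realType) (V : hilbertType R)
    (A : operator V) : self_adjoint A ->
  forall u v, opdom A u -> opdom A v -> braket (A u) v = braket u (A v).
Proof. by move=> [_ _ adjA] u v Au Av; apply: (adjA v (A v)).1. Qed.

(** * Product vectors: brackets, norms and linearity in one slot *)

Section HilbertTensor.
Variables (R : realType) (J : finType) (K : J -> hilbertType R).
Variables (T : hilbertType R) (tens : (forall j, K j) -> T).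
Hypothesis tensP : is_hilbert_tensor tens.
Implicit Types (x y : forall j, K j).

Lemma dfwith_id x i : dfwith x i (x i) = x.
Proof. by apply: functional_extensionality_dep => j; case: dfwithP. Qed.

Lemma braket_tens x y : braket (tens x) (tens y) = \prod_j braket (x j) (y j).
Proof. by case: tensP. Qed.

Lemma braket_tens_dfwithl x y i u :
  braket (tens (dfwith x i u)) (tens y) =
    braket u (y i) * \prod_(j | j != i) braket (x j) (y j).
Proof.
rewrite braket_tens (bigD1 i)//= dfwithin; congr (_ * _).
by apply: eq_bigr => j ji; rewrite dfwithout// eq_sym.
Qed.

Lemma braket_tens_dfwithr x y i u :
  braket (tens x) (tens (dfwith y i u)) =
    braket (x i) u * \prod_(j | j != i) braket (x j) (y j).
Proof.
rewrite braket_tens (bigD1 i)//= dfwithin; congr (_ * _).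
by apply: eq_bigr => j ji; rewrite dfwithout// eq_sym.
Qed.

Lemma braket_tens_dfwith x y i u v :
  braket (tens (dfwith x i u)) (tens (dfwith y i v)) =
    braket u v * \prod_(j | j != i) braket (x j) (y j).
Proof.
rewrite braket_tens_dfwithl dfwithin; congr (_ * _).
by apply: eq_bigr => j ji; rewrite dfwithout// eq_sym.
Qed.

Lemma tens_dfwithZD x i a u v :
  tens (dfwith x i (a *: u + v)) =
    a *: tens (dfwith x i u) + tens (dfwith x i v).
Proof. by case: tensP. Qed.

Lemma tens_dfwith0 x i : tens (dfwith x i 0) = 0.
Proof.
have := @tens_dfwithZD x i (-1) 0 0.
by rewrite scaler0 addr0 scaleN1r addNr.
Qed.

Lemma tens_dfwithB x i u v :
  tens (dfwith x i (u - v)) = tens (dfwith x i u) - tens (dfwith x i v).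
Proof. by rewrite addrC -scaleN1r tens_dfwithZD scaleN1r addrC. Qed.

Lemma norm_tens x : `|tens x| = \prod_j `|x j|.
Proof.
apply/eqP; rewrite -(@eqrXn2 _ 2)// ?prodr_ge0// -prodrXl sqr_normE braket_tens.
by apply/eqP/eq_bigr => j _; rewrite sqr_normE.
Qed.

Lemma norm_tens_dfwith x i u :
  `|tens (dfwith x i u)| = `|u| * \prod_(j | j != i) `|x j|.
Proof.
rewrite norm_tens (bigD1 i)//= dfwithin; congr (_ * _).
by apply: eq_bigr => j ji; rewrite dfwithout// eq_sym.
Qed.

End HilbertTensor.

(** * Site operators on algebraic tensors *)

Section SiteGraph.
Variables (R : realType) (H : hilbertType R) (T : tensor_powers H).
Variables (A : operator H) (n : nat).
Hypothesis hA : self_adjoint A.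

Definition site_graph (i : 'I_n) : set (T n * T n) :=
  [set (ptens T x, ptens T (dfwith x i (A (x i))))
     | x in [set x : 'I_n -> H | opdom A (x i)]].

(** Membership in the domain makes the set given to [xget] nonempty, so the default 0 is not what is
    returned. *)
Lemma site_opP (i : 'I_n) psi : opdom (site_op T A i) psi ->
  closure (lspan (site_graph i)) (psi, site_op T A i psi).
Proof.
case=> w cw; pose S := [set w | closure (lspan (site_graph i)) (psi, w)].
exact: (@xgetPex _ 0 S (ex_intro _ w cw)).
Qed.

Lemma symmetric_site_graph i : symmetric_graph (site_graph i).
Proof.
move=> _ _ [x Ax <-] [y Ay <-] /=.
rewrite (braket_tens_dfwithl (ptensP T n)) (braket_tens_dfwithr (ptensP T n)).
by rewrite (self_adjoint_symmetric hA).
Qed.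

(** Product vectors span a dense subspace, and in each of them the factor at [i] can be moved
    slightly into the dense domain of [A]. *)
Lemma site_graph_dense i u (e : R[i]) : 0 < e ->
  exists2 q, lspan (site_graph i) q & `|u - q.1| < e.
Proof.
have [_ dA _] := hA; have [_ _ dT] := ptensP T n.
move=> e0; have e20 : 0 < e / 2 by rewrite divr_gt0.
suff span_dense : forall v, lspan (range (@ptens R H T n)) v ->
    forall e : R[i], 0 < e ->
    exists2 q, lspan (site_graph i) q & `|v - q.1| < e.
  have [v Sv uv] := dense_norm dT u e20.
  have [q Gq vq] := span_dense _ Sv _ e20; exists q => //.
  by rewrite (splitr e) (le_lt_trans (ler_distD v _ _))// ltrD.
apply: lspan_ind.
- by move=> ? ?; exists 0; [exact: lspan0|rewrite subr0 normr0].
- move=> a v w IHv IHw {e0 e20}e e0.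
  have a1 : 0 < `|a| + 1 by rewrite ltr_wpDl.
  have [|p Gp vp] := IHv (e / 2 / (`|a| + 1)); first by rewrite !divr_gt0.
  have [|q Gq wq] := IHw (e / 2); first by rewrite divr_gt0.
  exists (a *: p + q); first exact: lspan_linear.
  rewrite (_ : _ - _ = a *: (v - p.1) + (w - q.1)); last first.
    by rewrite scalerBr addrACA -opprD.
  rewrite (splitr e) (le_lt_trans (ler_normD _ _))// ler_ltD// normrZ.
  rewrite ltr_pdivlMr// in vp.
  by rewrite (le_trans _ (ltW vp))// mulrDr mulr1 mulrC lerDl.
- move=> _ [x _ <-] {e0 e20}e e0; set P := \prod_(j | j != i) `|x j|.
  (* The added 1 allows for [P = 0]. *)
  have P1 : 0 < P + 1 by rewrite ltr_wpDl// prodr_ge0.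
  have [|v Av xv] := dense_norm dA (x i) (e := e / (P + 1)).
    by rewrite divr_gt0.
  exists (ptens T (dfwith x i v), ptens T (dfwith x i (A v))).
    apply: sub_lspan; exists (dfwith x i v) => /=; first by rewrite dfwithin.
    congr (_, ptens T _); apply/funext => j.
    case: (eqVneq i j) => [<-|ij]; first by rewrite !dfwithin.
    by rewrite !dfwithout.
  rewrite -[x in ptens T x - _](dfwith_id x i) /=.
  rewrite -(tens_dfwithB (ptensP T n)) (norm_tens_dfwith (ptensP T n)).
  rewrite ltr_pdivlMr// in xv; apply: le_lt_trans xv.
  by rewrite mulrDr mulr1 lerDl.
Qed.

End SiteGraph.

(** * Factorization of brackets across the blocks of a separable state *)

Section Separable.
Variables (R : realType) (H : hilbertType R) (T : tensor_powers H).
Variables (A : operator H) (n l : nat) (r : 'I_l -> nat).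
Variables (s : {b : 'I_l & 'I_(r b)} -> 'I_n).
Variables (m : (forall b, T (r b)) -> T n) (phi : forall b, T (r b)).
Hypotheses (hA : self_adjoint A) (s_bij : bijective s).
Hypotheses (sm : is_regrouping s m) (psi1 : is_pure_state (m phi)).
Let psi := m phi.
Local Notation site j := (s (Tagged (fun b => 'I_(r b)) j)).
Let mP : is_hilbert_tensor m. Proof. by case: sm. Qed.

Definition block_tensors (x : 'I_n -> H) (b : 'I_l) : T (r b) :=
  ptens T (fun j => x (site j)).

Lemma regroup_ptens x : m (block_tensors x) = ptens T x.
Proof. by case: sm => _ ->. Qed.

(** Since [s] is injective, a change at the site of [j] is seen by slot [j] of block [b] and by no
    other slot; the next lemma is the counterpart for the other blocks. *)
Lemma block_tensors_in x b (j : 'I_(r b)) u :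
  block_tensors (dfwith x (site j) u) b =
  ptens T (dfwith (fun j => x (site j)) j u).
Proof.
congr (ptens T _); apply/funext => j'.
have [<-|jj'] := eqVneq j j'; first by rewrite !dfwithin.
by rewrite !dfwithout// (inj_eq (bij_inj s_bij)) eq_sym eq_Tagged /= eq_sym.
Qed.

Lemma block_tensors_out x b (j : 'I_(r b)) u c : b != c ->
  block_tensors (dfwith x (site j) u) c = block_tensors x c.
Proof.
move=> bc; congr (ptens T _); apply/funext => j'.
rewrite dfwithout// (inj_eq (bij_inj s_bij)).
by apply: contraNneq bc => /(congr1 tag)/= ->.
Qed.

Definition slice (b : 'I_l) : set (T n) :=
  [set m (dfwith phi b t) | t in [set: T (r b)]].

Lemma slice_psi b : slice b psi.
Proof. by exists (phi b) => //; rewrite dfwith_id. Qed.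

Lemma slice0 b : slice b 0.
Proof. by exists 0 => //; rewrite tens_dfwith0. Qed.

Lemma slice_linear b a u v : slice b u -> slice b v -> slice b (a *: u + v).
Proof.
by move=> [t _ <-] [t' _ <-]; exists (a *: t + t'); rewrite ?tens_dfwithZD.
Qed.

Lemma prod_norm_phi : \prod_b braket (phi b) (phi b) = 1.
Proof. by rewrite -(braket_tens mP) -sqr_normE psi1 expr1n. Qed.

Lemma prod_norm_phi_neq0 b : \prod_(c | c != b) braket (phi c) (phi c) != 0.
Proof.
apply/eqP => N0; have /eqP := prod_norm_phi.
by rewrite (bigD1 b)//= N0 mulr0 eq_sym oner_eq0.
Qed.

(** A product vector projects to the slice by keeping its block [b], replacing the other blocks by
    those of [phi], and rescaling. The scalar ignores block [b], so the site operator at [j] leaves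
    it unchanged, and weak commutation reduces to the symmetry of [A]. *)
Lemma slice_compression b (j : 'I_(r b)) p :
  site_graph A (site j) p ->
  exists q, compression (slice b) (site_graph A (site j)) p q.
Proof.
move=> [x Ax <-] {p}; set i := s _ in Ax *; set x' := dfwith x i _.
pose N := \prod_(c | c != b) braket (phi c) (phi c).
pose C (y : 'I_n -> H) :=
  \prod_(c | c != b) braket (phi c) (block_tensors y c).
have N0 : N != 0 by exact: prod_norm_phi_neq0.
have CE y u : C (dfwith y i u) = C y.
  by apply: eq_bigr => c cb; rewrite block_tensors_out// eq_sym.
(* The scalar is frozen at [C x], so that it is shared by [q x] and [q x']; [CE] shows that it is
   the right one for [x'] too. *)
pose q y := m (dfwith phi b ((C x / N) *: block_tensors y b)).
have orthoq y : C y = C x -> orthoset (slice b) (ptens T y - q y).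
  move=> yx _ [t _ <-]; rewrite braketBr -regroup_ptens /q.
  rewrite (braket_tens_dfwithl mP) (braket_tens_dfwith mP) -/N -/(C y) yx.
  by rewrite braketZr; field.
exists (q x, q x'); split=> /=.
- by split; eexists.
- exact: orthoq.
- exact: orthoq (CE _ _).
- move=> _ [y Ay <-] /=; rewrite -!regroup_ptens.
  rewrite !(braket_tens_dfwithl mP) -/(C y) -/(C (dfwith y i _)) CE.
  rewrite !braketZl; congr (_ * _ * _).
  rewrite !block_tensors_in {1}/block_tensors.
  rewrite (braket_tens_dfwithr (ptensP T (r b))).
  rewrite (braket_tens_dfwithl (ptensP T (r b))).
  by rewrite (self_adjoint_symmetric hA).
Qed.

(** Double orthogonality is the weak form of [w] lying in the slice. *)
Lemma site_op_ortho b (j : 'I_(r b)) w z :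
  closure (lspan (site_graph A (site j))) (psi, w) ->
  orthoset (slice b) z -> braket w z = 0.
Proof.
move=> cw; apply: (closure_graph_ortho _ _ _ _ _ cw).
- exact: slice0.
- exact: slice_linear.
- exact: symmetric_site_graph.
- by move=> u e; apply: site_graph_dense.
- exact: slice_compression.
- exact: slice_psi.
Qed.

Lemma slices_braket b c u v : b != c -> slice b u -> slice c v ->
  braket u v = braket u psi * braket psi v.
Proof.
move=> bc [t _ <-] [t' _ <-].
have cb : c != b by rewrite eq_sym.
pose Q := \prod_(d | (d != b) && (d != c)) braket (phi d) (phi d).
have Eb : \prod_(d | d != b) braket (phi d) (phi d) =
          braket (phi c) (phi c) * Q.
  by rewrite (bigD1 c).
have Ec : \prod_(d | d != c) braket (phi d) (phi d) =
          braket (phi b) (phi b) * Q.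
  by rewrite (bigD1 b)//=; congr (_ * _); apply: eq_bigl => d; rewrite andbC.
have := prod_norm_phi; rewrite (bigD1 b)//= Eb => phi1.
rewrite [in RHS](braket_tens_dfwithl mP) [in RHS](braket_tens_dfwithr mP) Eb Ec.
rewrite (braket_tens_dfwithl mP) dfwithout// (bigD1 c)//= dfwithin.
rewrite (_ : \prod_(_ | _) _ = Q); last first.
  by apply: eq_bigr => d /andP[_ dc]; rewrite dfwithout// eq_sym.
(* The right side has the extra factor [<phi b|phi b> <phi c|phi c> Q], which is the squared norm 1
   of [psi]. *)
rewrite -[LHS]mulr1 -phi1; ring.
Qed.

(** The formula of [slices_braket] is transferred to [w] and [v] by applying [site_op_ortho] twice:
    first [w] is replaced by an arbitrary [u] in the slice of [b], then [v] by an arbitrary [u'] in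
    the slice of [c]. *)
Lemma cross_braket b c (j : 'I_(r b)) (k : 'I_(r c)) w v : b != c ->
  closure (lspan (site_graph A (site j))) (psi, w) ->
  closure (lspan (site_graph A (site k))) (psi, v) ->
  braket w v = braket w psi * braket psi v.
Proof.
move=> bc cw cv; have psipsi : braket psi psi = 1.
  by rewrite -sqr_normE psi1 expr1n.
suff /(site_op_ortho cw) : orthoset (slice b) (v - braket psi v *: psi).
  by rewrite braketBr braketZr mulrC => /subr0_eq.
move=> u ub; rewrite braketBr braketZr (mulrC (braket psi v)).
suff /(site_op_ortho cv) : orthoset (slice c) (u - braket psi u *: psi).
  rewrite braketBr braketZr => /subr0_eq vu.
  by rewrite (braketC v u) vu (braketC psi u) (braketC v psi) -rmorphM subrr.
move=> u' cu'; rewrite braketBr braketZr mulrC.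
have cb : c != b by rewrite eq_sym.
by rewrite (slices_braket cb cu' ub) subrr.
Qed.

End Separable.

(** * The real covariance form of a state *)

Section Covariance.
Variables (R : realType) (V : hilbertType R) (psi : V).
Implicit Types u v w : V.

(** Taking real parts makes the form symmetric; at [u = v = A psi] it is the variance of [A]. *)
Definition qcovariance u v : R :=
  complex.Re (braket u v)
  - complex.Re (braket psi u) * complex.Re (braket psi v).

Lemma ReD (z z' : R[i]) : complex.Re (z + z') = complex.Re z + complex.Re z'.
Proof. by case: z; case: z'. Qed.

Lemma qcovarianceDl u v w :
  qcovariance (u + v) w = qcovariance u w + qcovariance v w.
Proof. by rewrite /qcovariance !(braketDl, braketDr) !ReD; ring. Qed.

Lemma qcovarianceC u v : qcovariance u v = qcovariance v u.
Proof.
rewrite /qcovariance [X in _ - X]mulrC; congr (_ - _).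
by rewrite braketC; case: braket.
Qed.

Lemma qcovarianceDr u v w :
  qcovariance u (v + w) = qcovariance u v + qcovariance u w.
Proof. by rewrite qcovarianceC qcovarianceDl !(qcovarianceC u). Qed.

Lemma qcovariance0l u : qcovariance 0 u = 0.
Proof. by rewrite /qcovariance braket0l braket0r /= mul0r subr0. Qed.

Lemma qcovariance0r u : qcovariance u 0 = 0.
Proof. by rewrite qcovarianceC qcovariance0l. Qed.

Lemma qcovarianceNl u v : qcovariance (- u) v = - qcovariance u v.
Proof.
by apply/eqP; rewrite -subr_eq0 opprK -qcovarianceDl addNr qcovariance0l.
Qed.

Lemma qcovariance_sum (I J : finType) (f : I -> V) (g : J -> V) :
  qcovariance (\sum_i f i) (\sum_j g j) = \sum_i \sum_j qcovariance (f i) (g j).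
Proof.
rewrite (big_morph (qcovariance^~ _) (fun u v => qcovarianceDl u v _)
  (qcovariance0l _)).
apply: eq_bigr => i _.
exact: (big_morph _ (qcovarianceDr _) (qcovariance0r _)).
Qed.

Hypothesis psi1 : is_pure_state psi.

(** Cauchy-Schwarz against the unit vector [psi], dropping the squared imaginary part of
    [<psi|u>]. *)
Lemma qcovariance_ge0 u : 0 <= qcovariance u u.
Proof.
have := cauchy_schwarz psi u; rewrite psi1 mul1r.
rewrite -(@ler_pXn2r _ 2) ?nnegrE// sqr_normE -add_Re2_Im2 lecE.
move=> /andP[_ /= le].
by rewrite /qcovariance subr_ge0 (le_trans _ le)// -expr2 lerDl sqr_ge0.
Qed.

(** Nonnegativity at [u - v] bounds twice the covariance by the sum of the two variances. *)
Lemma qcovariance_le M u v :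
  qcovariance u u <= M -> qcovariance v v <= M -> qcovariance u v <= M.
Proof.
have := qcovariance_ge0 (u - v).
rewrite qcovarianceDl !qcovarianceDr !qcovarianceNl !(qcovarianceC _ (- v)).
rewrite !qcovarianceNl (qcovarianceC v u); lra.
Qed.

(** The first hypothesis makes [<psi|u>] real, so the real part of the product is the product of the
    real parts. *)
Lemma qcovariance_eq0 u v : braket u psi = braket psi u ->
  braket u v = braket u psi * braket psi v -> qcovariance u v = 0.
Proof.
rewrite /qcovariance => upsi ->; rewrite upsi.
have : braket psi u = (braket psi u)^* by rewrite -braketC.
move/eqP; case: (braket psi u) => a b; case: (braket psi v) => c d.
rewrite eq_complex /= => /andP[_ /eqP bb].
have -> : b = 0 by lra.
by rewrite mul0r subr0 subrr.
Qed.

End Covariance.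

(** * Sums of squared block sizes *)

Section BlockSizes.

(** A new block of size [r] is merged with the remainder [s] of [n]: either both fit below [k], or
    they fill a block of size [k] and leave [t = r + s - k]. *)
Lemma sum_sqr_step (k n r : nat) : (0 < k)%N -> (r <= k)%N ->
  (n %/ k * k ^ 2 + (n %% k) ^ 2 + r ^ 2 <=
   (r + n) %/ k * k ^ 2 + ((r + n) %% k) ^ 2)%N.
Proof.
move=> k0 rk; have sk := ltn_pmod n k0.
rewrite {3 4}(divn_eq n k) addnCA divnMDl// modnMDl.
move: (n %/ k)%N (n %% k)%N sk => q s sk.
have [rs|rs] := ltnP (r + s) k.
  by rewrite divn_small// modn_small//; nia.
have -> : (r + s = 1 * k + (r + s - k))%N by lia.
have tk : (r + s - k < k)%N by lia.
rewrite divnMDl// modnMDl divn_small// modn_small//.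
have : (r + s - k + k = r + s)%N by lia.
move: (r + s - k)%N => t ht.
(* The gain [k^2 + t^2 - s^2 - r^2] equals [2 (k - s) (k - r)]. *)
have : (0 <= (k - s) * (k - r))%N by [].
nia.
Qed.

Lemma sum_sqr_le (k : nat) (I : finType) (r : I -> nat) : (0 < k)%N ->
  (forall i, r i <= k)%N ->
  (\sum_i r i ^ 2 <=
   (\sum_i r i) %/ k * k ^ 2 + ((\sum_i r i) %% k) ^ 2)%N.
Proof.
move=> k0 rk; elim/big_rec2: _ => [//|i n q _ IH].
by apply: leq_trans (sum_sqr_step _ k0 (rk i)); rewrite addnC leq_add2r.
Qed.

Lemma modn_sub (n k : nat) : (n - n %/ k * k = n %% k)%N.
Proof. by rewrite {1}(divn_eq n k) addKn. Qed.

Lemma sum_sqr_bound_le (n k : nat) : (0 < k)%N ->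
  (n %/ k * k ^ 2 + (n %% k) ^ 2 <= n * k)%N.
Proof.
move=> k0; have sk := ltn_pmod n k0.
by rewrite {3}(divn_eq n k) mulnDl -mulnA leq_add2l -mulnn leq_mul2l ltnW ?orbT.
Qed.

Lemma sum_tag (V : nmodType) (I : finType) (r : I -> nat) (F : I -> V) :
  \sum_(p : {b : I & 'I_(r b)}) F (tag p) = \sum_b F b *+ r b.
Proof.
rewrite -(sig_big_dep xpredT (fun=> xpredT) (fun b (_ : 'I_(r b)) => F b)) /=.
by apply: eq_bigr => b _; rewrite sumr_const card_ord.
Qed.

Lemma sum_same_block (R : realType) (I : finType) (r : I -> nat) (M : R) :
  \sum_(p : {b : I & 'I_(r b)}) \sum_(q : {b : I & 'I_(r b)})
     (if tag p == tag q then M else 0) = M * (\sum_b r b ^ 2)%N%:R.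
Proof.
rewrite (sum_tag r (fun b => \sum_q (if b == tag q then M else 0))).
rewrite natr_sum mulr_sumr; apply: eq_bigr => b _.
rewrite (sum_tag r (fun c => if b == c then M else 0)) (bigD1 b)//= eqxx.
rewrite big1 ?addr0 => [|c cb]; last by rewrite eq_sym (negPf cb) mul0rn.
by rewrite -mulrnA mulr_natr mulnn.
Qed.

End BlockSizes.

Theorem mainTheorem10 (R : realType) (H : hilbertType R) (A : operator H)
    (hA : self_adjoint A) (hnd : nondegenerate_spectrum A)
    (T : tensor_powers H) (n k : nat) (hkn : (1 <= k <= n)%N)
    (psi : T n) (hpsi : is_pure_state psi)
    (hdom : forall i : 'I_n, opdom (site_op T A i) psi)
    (hsep : k_separable k psi) :
  Findex A psi <= (n %/ k * k ^ 2 + (n - n %/ k * k) ^ 2)%N%:R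
  /\ (n %/ k * k ^ 2 + (n - n %/ k * k) ^ 2 <= n * k)%N.
Proof.
have /andP[k0 _] := hkn; rewrite modn_sub; split; last exact: sum_sqr_bound_le.
have [l [r [s [m [phi [rk s_bij sm psiE]]]]]] := hsep.
have nE : n = (\sum_b r b)%N.
  rewrite -[LHS]card_ord -(bij_eq_card s_bij) card_tagged sumnE big_map.
  by rewrite big_enum; apply: eq_bigr => b _; rewrite card_ord.
rewrite /Findex; case: eqVneq => [//|M0].
set M := max_site_variance A psi in M0 *.
have Mge0 : 0 <= M by exact: bigmax_ge_id.
have Mgt0 : 0 < M by rewrite lt_neqAle eq_sym M0.
rewrite ler_pdivrMr// mulrC.
pose w i := site_op T A i psi.
have cw i : closure (lspan (site_graph A i)) (psi, w i) by apply: site_opP.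
(* Symmetry of the closed graph, applied to one pair against itself, shows that the site
   expectations are real. *)
have wsym i : braket (w i) psi = braket psi (w i).
  exact: symmetric_closure (symmetric_site_graph hA (i := i)) _ _ (cw i) (cw i).
have varM i : qcovariance psi (w i) (w i) <= M.
  rewrite /qcovariance -expr2.
  exact: (le_bigmax _ (fun i => Defs.variance (site_op T A i) psi)).
have -> : Defs.variance (coll_op T A n) psi =
    qcovariance psi (\sum_i w i) (\sum_i w i) by rewrite /Defs.variance expr2.
(* Sites are indexed by block and slot, so that the double sum can be compared termwise with [M]
   times the indicator of a common block. *)
rewrite qcovariance_sum (reindex s) /=; last exact: onW_bij.
apply: (@le_trans _ _ (M * (\sum_b r b ^ 2)%N%:R)); last first.
  rewrite ler_pM2l// ler_nat nE; apply: sum_sqr_le => // b.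
  by case/andP: (rk b).
rewrite -sum_same_block; apply: ler_sum => -[b j] _.
rewrite (reindex s) /=; last exact: onW_bij.
apply: ler_sum => -[c i] _ /=; have [_|bc] := eqVneq.
  exact: qcovariance_le.
rewrite (@qcovariance_eq0 _ _ psi)//; subst psi.
exact: (cross_braket hA s_bij sm hpsi bc (cw _) (cw _)).
Qed.
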